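(* Let $(M,g)$ be a 6-dimensional (oriented) Riemannian spin manifold. Then $(M,g)$ carries a unit spinor field $\phi$ in the kernel of the Riemannian Dirac operator, $D\phi=0$, if and only if it admits an $\mathrm{SU}(3)$-structure (given by a unit spinor field $\phi$) of class $\chi_{2\bar2345}$ satisfying $\delta\omega=-2\eta$. Moreover, for any $\mathrm{SU}(3)$-structure $\phi$ on $(M,g)$ the complementary torsion components $\chi_1$ and $\chi_{\bar1}$, i.e. the components $\lambda J$ and $\mu\,\mathrm{Id}$ of $S$, are determined by the scalars $$\lambda=\tfrac16(D\phi,j(\phi))=-\tfrac16\mathrm{tr}(JS),\qquad \mu=-\tfrac16(D\phi,\phi)=\tfrac16\mathrm{tr}(S).$$
   Context: Conventions. $\Sigma$ is the real rank-8 spinor bundle of $M^6$, associated with the real 8-dimensional representation of the Clifford algebra of $\mathbb{R}^6$ ($X^2=-|X|^2$), with inner product $(\cdot,\cdot)$ for which vectors act skew-symmetrically; Clifford multiplication is juxtaposition. $\nabla$ is the Levi-Civita connection and its spinor lift, $D=\sum_ie_i\nabla_{e_i}$. The parallel endomorphism $j:=e_1e_2e_3e_4e_5e_6$ satisfies $j^2=-1$ and anticommutes with vectors. An $\mathrm{SU}(3)$-structure on $(M,g)$ is given by a unit spinor field $\phi$: it determines the orthogonal almost complex structure $J$ by $(JX)\phi=j(X\phi)$, the 2-form $\omega(X,Y)=g(X,JY)$, and unique $\eta\in\Omega^1(M)$, $S\in\Gamma(\mathrm{End}(TM))$ with $\nabla_X\phi=\eta(X)j(\phi)+S(X)\phi$.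 The codifferential is $\delta\omega(X)=-\sum_i(\nabla_{e_i}\omega)(e_i,X)$. Classes. At each point $(S,\eta)$ lies in the direct sum of: $\chi_1$: $S\in\mathbb{R}J$, $\eta=0$; $\chi_{\bar1}$: $S\in\mathbb{R}\,\mathrm{Id}$, $\eta=0$; $\chi_2$: $S\in\mathfrak{su}(3)$ (skew, commuting with $J$, $\mathrm{tr}(JS)=0$), $\eta=0$; $\chi_{\bar2}$: $S$ symmetric traceless, commuting with $J$, $\eta=0$; $\chi_3$: $S$ symmetric traceless, anticommuting with $J$, $\eta=0$; $\chi_4$: $S$ skew, anticommuting with $J$, $\eta=0$; $\chi_5$: $S=0$, $\eta$ arbitrary. Class $\chi_{2\bar2345}$ means that $(S,\eta)$ lies in $\chi_2\oplus\chi_{\bar2}\oplus\chi_3\oplus\chi_4\oplus\chi_5$ at every point. *)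

(* Defs.v *)
From HB Require Import structures.
From mathcomp Require Import all_boot all_order all_algebra.
From mathcomp Require Import all_classical all_reals all_analysis.

Set Implicit Arguments.
Unset Strict Implicit.
Unset Printing Implicit Defensive.

Import Order.TTheory GRing.Theory Num.Theory.
Import numFieldNormedType.Exports.

Local Open Scope classical_set_scope.
Local Open Scope ring_scope.

(* Tangent vectors are row vectors and endomorphisms of a tangent space are
   6 x 6 matrices acting on the right ([S v] is [v *m S]); covectors are
   columns ([eta v] is [(v *m eta) 0 0]).  Spinors are columns of height 8, on
   which 8 x 8 matrices act on the left. *)

Section Smooth.
Variables (R : realType) (V : normedModType R).

Fixpoint Ck_on (k : nat) (U : set 'rV[R]_6) (f : 'rV[R]_6 -> V) : Prop :=
  match k with
  | 0 => forall x, U x -> {for x, continuous f}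
  | k'.+1 => (forall x, U x -> differentiable f x) /\
             (forall v, Ck_on k' U (fun x => 'D_v f x))
  end.

Definition smooth_on (U : set 'rV[R]_6) (f : 'rV[R]_6 -> V) : Prop :=
  forall k, Ck_on k U f.

End Smooth.

(* [chart_at p] is a preferred chart around [p]; the tangent space at [p] is
   identified with 'rV_6 by the coordinates of that chart.  [coord a] and
   [param a] are total functions, meaningful on [dom a] and on its image. *)
Record manifold6 (R : realType) (M : topologicalType) := Manifold6 {
  chart : Type;
  dom : chart -> set M;
  coord : chart -> M -> 'rV[R]_6;
  param : chart -> 'rV[R]_6 -> M;
  chart_at : M -> chart;
  manifold_hausdorff : hausdorff_space M;
  manifold_second_countable : @second_countable M;
  dom_open : forall a, open (dom a);
  coord_dom_open : forall a, open (coord a @` dom a);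
  coordK : forall a p, dom a p -> param a (coord a p) = p;
  coord_continuous : forall a p, dom a p -> {for p, continuous (coord a)};
  param_continuous : forall a x, (coord a @` dom a) x ->
    {for x, continuous (param a)};
  transition_smooth : forall a b,
    smooth_on (coord a @` (dom a `&` dom b)) (coord b \o param a);
  dom_chart_at : forall p, dom (chart_at p) p
}.

Section Manifold.
Variables (R : realType) (M : topologicalType) (A : manifold6 R M).

Definition smooth (V : normedModType R) (U : set M) (f : M -> V) : Prop :=
  forall a : chart A, smooth_on (coord a @` (dom a `&` U)) (f \o param a).

(* Derivative at [p] of [f] along the tangent vector [v] at [p]. *)
Definition der (V : normedModType R) (p : M) (v : 'rV[R]_6) (f : M -> V) : V :=
  'D_v (f \o param (chart_at A p)) (coord (chart_at A p) p).

Definition vfield := M -> 'rV[R]_6.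

(* [X] is smooth on [U] iff it maps smooth functions on open subsets of [U] to
   smooth functions. *)
Definition smooth_vf (U : set M) (X : vfield) : Prop :=
  forall (W : set M) (f : M -> R^o), open W -> W `<=` U ->
    smooth W f -> smooth W (fun q => der q (X q) f).

Record metric := Metric {
  gram : M -> 'M[R]_6;
  gram_sym : forall p, (gram p)^T = gram p;
  gram_pos : forall p (v : 'rV[R]_6), v != 0 -> 0 < (v *m gram p *m v^T) 0 0;
  gram_smooth : forall U X Y, open U -> smooth_vf U X -> smooth_vf U Y ->
    smooth U (fun q => (X q *m gram q *m (Y q)^T) 0 0 : R^o)
}.

Variable g : metric.

Definition inner (p : M) (v w : 'rV[R]_6) : R := (v *m gram g p *m w^T) 0 0.

(* [nabla Y p v] is the covariant derivative of [Y] at [p] along [v], for [Y]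
   any vector field that is smooth around [p]. *)
Record levi_civita := LeviCivita {
  nabla : vfield -> M -> 'rV[R]_6 -> 'rV[R]_6;
  nabla_linear : forall U Y p, open U -> U p -> smooth_vf U Y ->
    forall (c : R) v w, nabla Y p (c *: v + w) = c *: nabla Y p v + nabla Y p w;
  nabla_add : forall U Y Z p v, open U -> U p -> smooth_vf U Y ->
    smooth_vf U Z ->
    nabla (fun q => Y q + Z q) p v = nabla Y p v + nabla Z p v;
  nabla_leibniz : forall U (f : M -> R^o) Y p v, open U -> U p ->
    smooth U f -> smooth_vf U Y ->
    nabla (fun q => f q *: Y q) p v = der p v f *: Y p + f p *: nabla Y p v;
  nabla_local : forall U Y Z p v, open U -> U p -> smooth_vf U Y ->
    smooth_vf U Z -> (forall q, U q -> Y q = Z q) -> nabla Y p v = nabla Z p v;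
  nabla_smooth : forall U X Y, open U -> smooth_vf U X -> smooth_vf U Y ->
    smooth_vf U (fun q => nabla Y q (X q));
  nabla_metric : forall U Y Z p v, open U -> U p -> smooth_vf U Y ->
    smooth_vf U Z ->
    der p v (fun q => inner q (Y q) (Z q) : R^o) =
    inner p (nabla Y p v) (Z p) + inner p (Y p) (nabla Z p v);
  (* nabla_X Y - nabla_Y X = [X, Y], as derivations *)
  nabla_torsion_free : forall U X Y p (f : M -> R^o), open U -> U p ->
    smooth_vf U X -> smooth_vf U Y -> smooth U f ->
    der p (nabla Y p (X p) - nabla X p (Y p)) f =
    der p (X p) (fun q => der q (Y q) f) - der p (Y p) (fun q => der q (X q) f)
}.

End Manifold.

Section Clifford.
Variable R : realType.

(* The Clifford algebra of R^6 with X^2 = - |X|^2 is isomorphic to 'M[R]_8, so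
   that any such representation is irreducible, faithful, and unique up to
   equivalence. *)
Record clifford_rep := CliffordRep {
  cgen : 'I_6 -> 'M[R]_8;
  cgen_skew : forall i, (cgen i)^T = - cgen i;
  cgen_rel : forall i k,
    cgen i *m cgen k + cgen k *m cgen i = (- (i == k)%:R *+ 2)%:M
}.

Variable c : clifford_rep.

Definition cvec (x : 'rV[R]_6) : 'M[R]_8 := \sum_i x 0 i *: cgen c i.

(* Spin(6), as the even products of unit vectors. *)
Definition is_spin (h : 'M[R]_8) : Prop :=
  exists s : seq 'rV[R]_6, [/\ ~~ odd (size s),
    forall x, x \in s -> \sum_i x 0 i ^+ 2 = 1 & h = \prod_(x <- s) cvec x].

(* e_1 e_2 e_3 e_4 e_5 e_6 *)
Definition jmx : 'M[R]_8 := \prod_(i < 6) cgen c i.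

End Clifford.

(* A spin structure, together with the orientation it induces, given by local
   sections of the spin bundle: on the open set [gdom k] such a section induces
   the oriented orthonormal frame [frame k], and [slift k l] is the Spin(6)-valued
   transition function between the sections on [gdom k] and [gdom l].
   [spin_lift] says that it covers the transition function between the frames:
   h c(x) h^-1 = c(y) when x and y are the coordinates of the same tangent
   vector in the frames [l] and [k]. *)
Record spin_structure (R : realType) (M : topologicalType) (A : manifold6 R M)
    (g : metric A) (c : clifford_rep R) := SpinStructure {
  gauge : Type;
  gdom : gauge -> set M;
  frame : gauge -> 'I_6 -> vfield R M;
  slift : gauge -> gauge -> M -> 'M[R]_8;
  gauge_at : M -> gauge;
  gdom_open : forall k, open (gdom k);
  frame_smooth : forall k i, smooth_vf A (gdom k) (frame k i);
  frame_orthonormal : forall k p, gdom k p ->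
    forall i i', inner g p (frame k i p) (frame k i' p) = (i == i')%:R;
  lift_smooth : forall k l, smooth A (gdom k `&` gdom l) (slift k l);
  lift_spin : forall k l p, gdom k p -> gdom l p -> is_spin c (slift k l p);
  spin_lift : forall k l p, gdom k p -> gdom l p -> forall i,
    slift k l p *m cgen c i =
    (\sum_i' inner g p (frame l i p) (frame k i' p) *: cgen c i') *m slift k l p;
  lift_cocycle : forall k l m p, gdom k p -> gdom l p -> gdom m p ->
    slift k l p *m slift l m p = slift k m p;
  gdom_gauge_at : forall p, gdom (gauge_at p) p
}.

Section Spinors.
Variables (R : realType) (M : topologicalType) (A : manifold6 R M).
Variables (g : metric A) (c : clifford_rep R) (sp : spin_structure g c).
Variable nb : levi_civita g.

(* The fibre of the spinor bundle at [p] is identified with 'cV_8 by the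
   section of the spin bundle of index [gauge_at sp p]. *)
Definition sfield := M -> 'cV[R]_8.

Local Notation fr p := (frame (gauge_at sp p)).

(* The expression of a spinor field in the local section of index [k]. *)
Definition in_gauge (k : gauge sp) (phi : sfield) : M -> 'cV[R]_8 :=
  fun q => slift k (gauge_at sp q) q *m phi q.

Definition smooth_sf (phi : sfield) : Prop :=
  forall k, smooth A (gdom k) (in_gauge k phi).

Definition sinner (u v : 'cV[R]_8) : R := (u^T *m v) 0 0.

Definition unit_spinor_field (phi : sfield) : Prop :=
  smooth_sf phi /\ forall p, sinner (phi p) (phi p) = 1.

Definition cmul (p : M) (v : 'rV[R]_6) (u : 'cV[R]_8) : 'cV[R]_8 :=
  cvec c (\row_i inner g p v (fr p i p)) *m u.

Definition jmul (u : 'cV[R]_8) : 'cV[R]_8 := jmx c *m u.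

(* nabla_v phi = v(phi) + 1/2 sum_(a < b) g(nabla_v e_a, e_b) e_a e_b phi *)
Definition snabla (phi : sfield) (p : M) (v : 'rV[R]_6) : 'cV[R]_8 :=
  der A p v (in_gauge (gauge_at sp p) phi) +
  2^-1 *: \sum_(a < 6) \sum_(b < 6 | (a < b)%N)
    inner g p (nabla nb (fr p a) p v) (fr p b p) *:
      cmul p (fr p a p) (cmul p (fr p b p) (phi p)).

Definition dirac_op (phi : sfield) : sfield :=
  fun p => \sum_i cmul p (fr p i p) (snabla phi p (fr p i p)).

(* A unit spinor field phi determines J by (J v) phi = j (v phi). *)
Definition acs (phi : sfield) (p : M) : 'M[R]_6 :=
  get [set J : 'M[R]_6 | forall v,
    cmul p (v *m J) (phi p) = jmul (cmul p v (phi p))].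

Definition omega (phi : sfield) (p : M) (v w : 'rV[R]_6) : R :=
  inner g p v (w *m acs phi p).

(* The pair (S, eta) with nabla_v phi = eta(v) j(phi) + S(v) phi. *)
Definition torsion (phi : sfield) (p : M) : 'M[R]_6 * 'cV[R]_6 :=
  get [set t : 'M[R]_6 * 'cV[R]_6 | forall v,
    snabla phi p v =
    (v *m t.2) 0 0 *: jmul (phi p) + cmul p (v *m t.1) (phi p)].

Definition Sof (phi : sfield) (p : M) : 'M[R]_6 := (torsion phi p).1.

Definition etaof (phi : sfield) (p : M) (v : 'rV[R]_6) : R :=
  (v *m (torsion phi p).2) 0 0.

(* (nabla_v w)(Y, Z) at p, for a 2-form w. *)
Definition nabla2 (w : M -> 'rV[R]_6 -> 'rV[R]_6 -> R) (p : M) (v : 'rV[R]_6)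
    (Y Z : vfield R M) : R :=
  der A p v (fun q => w q (Y q) (Z q) : R^o)
  - w p (nabla nb Y p v) (Z p) - w p (Y p) (nabla nb Z p v).

(* nabla_v w is tensorial, so it can be evaluated at z in T_p M through any local
   extension of z; here, the one with constant coordinates in the frame. *)
Definition extend (p : M) (z : 'rV[R]_6) : vfield R M :=
  fun q => \sum_i inner g p z (fr p i p) *: fr p i q.

Definition codiff (w : M -> 'rV[R]_6 -> 'rV[R]_6 -> R) (p : M) (z : 'rV[R]_6) : R :=
  - \sum_i nabla2 w p (fr p i p) (fr p i) (extend p z).

End Spinors.

(* The classes at a point, for a scalar product [b] and a complex structure [J]. *)
Section Classes.
Variables (R : realType) (b : 'rV[R]_6 -> 'rV[R]_6 -> R) (J : 'M[R]_6).

Local Notation T := ('M[R]_6 * 'cV[R]_6)%type.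

Definition selfadj (S : 'M[R]_6) := forall v w, b (v *m S) w = b v (w *m S).
Definition skewadj (S : 'M[R]_6) := forall v w, b (v *m S) w = - b v (w *m S).

Definition chi1 : set T := [set t | (exists l : R, t.1 = l *: J) /\ t.2 = 0].
Definition chi1bar : set T := [set t | (exists m : R, t.1 = m%:M) /\ t.2 = 0].
Definition chi2 : set T := [set t |
  [/\ skewadj t.1, t.1 *m J = J *m t.1, \tr (t.1 *m J) = 0 & t.2 = 0]].
Definition chi2bar : set T := [set t |
  [/\ selfadj t.1, \tr t.1 = 0, t.1 *m J = J *m t.1 & t.2 = 0]].
Definition chi3 : set T := [set t |
  [/\ selfadj t.1, \tr t.1 = 0, t.1 *m J = - (J *m t.1) & t.2 = 0]].
Definition chi4 : set T := [set t |
  [/\ skewadj t.1, t.1 *m J = - (J *m t.1) & t.2 = 0]].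
Definition chi5 : set T := [set t | t.1 = 0].

Definition chi22bar345 : set T := [set t | exists t2 t2b t3 t4 t5,
  [/\ [/\ chi2 t2, chi2bar t2b, chi3 t3, chi4 t4 & chi5 t5]
    & t = t2 + t2b + t3 + t4 + t5]].

(* [t1] and [t1b] are the components of [t] in chi_1 and chi_1bar. *)
Definition chi1_components (t t1 t1b : T) : Prop :=
  [/\ chi1 t1, chi1bar t1b &
    exists2 t', chi22bar345 t' & t = t1 + t1b + t'].

End Classes.

(* Main.v *)
Require Import Defs.
From HB Require Import structures.
From mathcomp Require Import all_boot all_order all_algebra.
From mathcomp Require Import all_classical all_reals all_analysis.
From mathcomp Require Import ring lra zify.

Set Implicit Arguments.
Unset Strict Implicit.
Unset Printing Implicit Defensive.

Import Order.TTheory GRing.Theory Num.Theory.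
Import numFieldNormedType.Exports.

Local Open Scope classical_set_scope.
Local Open Scope ring_scope.

(* For a unit spinor phi the vectors phi, j phi, e_1 phi, ..., e_6 phi form an
   orthonormal basis of the spinor space.  Since vectors act skew-symmetrically,
   the components of D phi = sum_i e_i nabla_(e_i) phi along phi and j phi are
   - tr S and - tr (J S), and (S, eta) lies in chi_(2 2bar 3 4 5) exactly when
   these two traces vanish.  In a gauge omega(Y, Z) = (Y phi, j Z phi), so that
   (nabla_X omega)(Y, Z) = (Y nabla_X phi, j Z phi) + (Y phi, j Z nabla_X phi);
   contracting X with Y and anticommuting e_i with Z gives
   delta omega (Z) = - 2 (D phi, j Z phi) - 2 eta(Z).  As j exchanges, up to sign,
   phi and j phi and preserves the span of the e_i phi, the condition
   delta omega = - 2 eta says that the remaining components of D phi vanish. *)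

(** * Clifford algebra *)

Section Sinner.
Variable R : realType.
Implicit Types (u v w : 'cV[R]_8) (B : 'M[R]_8).

Lemma sinnerC u v : sinner u v = sinner v u.
Proof. by rewrite /sinner -[u^T *m v]trmxK [LHS]mxE trmx_mul trmxK. Qed.

Lemma sinnerDl u v w : sinner (u + v) w = sinner u w + sinner v w.
Proof. by rewrite /sinner linearD mulmxDl mxE. Qed.

Lemma sinnerDr u v w : sinner u (v + w) = sinner u v + sinner u w.
Proof. by rewrite /sinner mulmxDr mxE. Qed.

Lemma sinnerZl a u v : sinner (a *: u) v = a * sinner u v.
Proof. by rewrite /sinner linearZ -scalemxAl mxE. Qed.

Lemma sinnerZr a u v : sinner u (a *: v) = a * sinner u v.
Proof. by rewrite /sinner -scalemxAr mxE. Qed.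

Lemma sinnerNl u v : sinner (- u) v = - sinner u v.
Proof. by rewrite -scaleN1r sinnerZl mulN1r. Qed.

Lemma sinnerNr u v : sinner u (- v) = - sinner u v.
Proof. by rewrite -scaleN1r sinnerZr mulN1r. Qed.

Lemma sinner0l u : sinner 0 u = 0.
Proof. by rewrite /sinner linear0 mul0mx mxE. Qed.

Lemma sinner_suml (I : Type) (r : seq I) (P : pred I) (F : I -> 'cV[R]_8) u :
  sinner (\sum_(i <- r | P i) F i) u = \sum_(i <- r | P i) sinner (F i) u.
Proof. by rewrite /sinner linear_sum mulmx_suml summxE. Qed.

Lemma sinner_sumr (I : Type) (r : seq I) (P : pred I) (F : I -> 'cV[R]_8) u :
  sinner u (\sum_(i <- r | P i) F i) = \sum_(i <- r | P i) sinner u (F i).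
Proof. by rewrite /sinner mulmx_sumr summxE. Qed.

Lemma sinner_mull B u v : sinner (B *m u) v = sinner u (B^T *m v).
Proof. by rewrite /sinner trmx_mul mulmxA. Qed.

Lemma sinner_skew B u v : B^T = - B -> sinner (B *m u) v = - sinner u (B *m v).
Proof. by move=> skB; rewrite sinner_mull skB mulNmx sinnerNr. Qed.

Lemma sinner_skew0 B u : B^T = - B -> sinner (B *m u) u = 0.
Proof.
move=> skB; have := sinner_skew u u skB; rewrite [sinner u _]sinnerC => ?; lra.
Qed.

End Sinner.

Section CliffordAlgebra.
Variables (R : realType) (c : clifford_rep R).
Implicit Types (x y : 'rV[R]_6) (u : 'cV[R]_8).

Local Notation cl := (cvec c).
Local Notation j := (jmx c).

Lemma cvec_is_linear : linear cl.
Proof.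
move=> a x y; rewrite /cvec scaler_sumr -big_split; apply: eq_bigr => i _.
by rewrite !mxE scalerDl scalerA.
Qed.

HB.instance Definition _ :=
  GRing.isLinear.Build R 'rV[R]_6 'M[R]_8 _ cl cvec_is_linear.

Lemma cvec_delta i : cl (delta_mx 0 i) = cgen c i.
Proof.
rewrite /cvec (bigD1 i) //= mxE !eqxx scale1r big1 ?addr0 // => k ki.
by rewrite mxE (negbTE ki) andbF scale0r.
Qed.

Lemma cvec_skew x : (cl x)^T = - cl x.
Proof.
rewrite /cvec linear_sum -sumrN; apply: eq_bigr => i _.
by rewrite linearZ /= cgen_skew scalerN.
Qed.

Lemma cvec_rel x y :
  cl x *m cl y + cl y *m cl x = (- 2 * (x *m y^T) 0 0)%:M.
Proof.
rewrite /cvec !mulmx_suml.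
under eq_bigr do rewrite mulmx_sumr.
under [X in _ + X]eq_bigr do rewrite mulmx_sumr.
rewrite [X in _ + X]exchange_big -big_split/=.
transitivity (\sum_i (- 2 * x 0 i * y 0 i)%:M : 'M[R]_8); last first.
  rewrite -rmorph_sum mxE mulr_sumr; congr _%:M.
  by apply: eq_bigr => i _; rewrite mxE mulrA.
apply: eq_bigr => i _; rewrite -big_split /= (bigD1 i) //= big1 ?addr0.
  rewrite -!scalemxAl -!scalemxAr !scalerA [y 0 i * _]mulrC -scalerDr cgen_rel.
  by rewrite eqxx mulr1n scale_scalar_mx; congr _%:M; ring.
move=> k ki; rewrite -!scalemxAl -!scalemxAr !scalerA [y 0 k * _]mulrC -scalerDr.
by rewrite cgen_rel eq_sym (negbTE ki) oppr0 mul0rn scale_scalar_mx mulr0 raddf0.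
Qed.

Lemma cvec_sqr x : cl x *m cl x = (- (x *m x^T) 0 0)%:M.
Proof.
have e := cvec_rel x x; apply: (@scalerI _ _ (2 : R)); rewrite ?pnatr_eq0 //.
by rewrite scaler_nat mulr2n e scale_scalar_mx; congr _%:M; ring.
Qed.

(** Each factor different from e_k costs one sign and each factor equal to e_k none; the exponent
    counts the latter twice, which keeps its parity right. *)
Lemma cgen_prod_comm (r : seq 'I_6) k :
  \prod_(i <- r) cgen c i * cgen c k =
  (-1) ^+ (size r + count_mem k r) *: (cgen c k * \prod_(i <- r) cgen c i).
Proof.
elim: r => [|i r IHr]; first by rewrite !big_nil mul1r mulr1 expr0 scale1r.
rewrite big_cons -mulrA IHr /= -scalerAr.
have [->|ik] := eqVneq i k.
  by rewrite addSn addnCA add1n !exprS !mulN1r opprK.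
rewrite [in LHS]mulrA.
have -> : cgen c i * cgen c k = - (cgen c k * cgen c i).
  apply/eqP; rewrite -addr_eq0; have := cgen_rel c i k.
  by rewrite (negbTE ik) oppr0 mul0rn raddf0 => ->.
by rewrite add0n addSn exprS mulN1r scaleNr mulNr scalerN -mulrA.
Qed.

Lemma size_index_ord n : size (index_enum 'I_n) = n.
Proof. by rewrite -sum1_size big_const_ord iter_addn_0 mul1n. Qed.

(** The exponent is 6 + 1: six factors, exactly one of which is e_k. *)
Lemma jmx_cgen k : j *m cgen c k = - (cgen c k *m j).
Proof.
have := cgen_prod_comm (index_enum 'I_6) k.
rewrite count_uniq_mem ?index_enum_uniq // mem_index_enum.
by rewrite size_index_ord -signr_odd scaleN1r.
Qed.

Lemma jmx_cvec x : j *m cl x = - (cl x *m j).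
Proof.
rewrite /cvec mulmx_sumr mulmx_suml -sumrN; apply: eq_bigr => i _.
by rewrite -scalemxAr -scalemxAl jmx_cgen scalerN.
Qed.

Lemma cgen_prod_tr (r : seq 'I_6) :
  (\prod_(i <- r) cgen c i)^T *m \prod_(i <- r) cgen c i = 1%:M.
Proof.
elim: r => [|i r IHr]; first by rewrite big_nil trmx1 mul1mx.
rewrite big_cons trmx_mul mulmxA -(mulmxA _ _ (cgen c i)) cgen_skew mulNmx.
rewrite -cvec_delta cvec_sqr trmx_delta mul_delta_mx mxE !eqxx rmorphN opprK.
by rewrite mulmx1 IHr.
Qed.

Lemma jmx_orth : j^T *m j = 1%:M.
Proof. exact: cgen_prod_tr. Qed.

(** Bringing equal factors together takes n(n-1)/2 transpositions and each of the n squares adds a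
    sign, n(n+1)/2 in total. For n = 6 this is 21, whence j^2 = -1. *)
Lemma cgen_prod_sqr (r : seq 'I_6) : uniq r ->
  \prod_(i <- r) cgen c i * \prod_(i <- r) cgen c i =
  (-1) ^+ ((size r).+1 * size r)./2 *: 1%:M.
Proof.
elim: r => [|i r IHr] /=; first by rewrite big_nil mulr1 scale1r.
case/andP=> ir ur; rewrite big_cons mulrA -(mulrA (cgen c i)) cgen_prod_comm.
rewrite -scalerAr -scalerAl (mulrA (cgen c i) (cgen c i)) -(mulrA (_ * _)) IHr //.
have -> : cgen c i * cgen c i = - 1.
  rewrite -cvec_delta; have := cvec_sqr (delta_mx 0 i); rewrite mulmxE => ->.
  by rewrite trmx_delta mul_delta_mx mxE !eqxx rmorphN.
rewrite (count_memPn ir) addn0 mulN1r -scaleNr scalerA mulrN -exprD -mulN1r -exprS.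
congr (_ ^+ _ *: _); lia.
Qed.

Lemma jmx_sqr : j *m j = - 1%:M.
Proof.
have := cgen_prod_sqr (index_enum_uniq 'I_6).
by rewrite size_index_ord -signr_odd scaleN1r.
Qed.

(** Being orthogonal with square -1, j has its inverse -j as transpose. *)
Lemma jmx_skew : j^T = - j.
Proof.
by rewrite -[j^T]mulmx1 -[1%:M]opprK -jmx_sqr mulmxN mulmxA jmx_orth mul1mx.
Qed.

End CliffordAlgebra.
(** * Pointwise geometry of a unit spinor *)

Section UnitSpinor.
Variables (R : realType) (c : clifford_rep R).
Implicit Types (x y : 'rV[R]_6) (u v : 'cV[R]_8).

Local Notation cl := (cvec c).
Local Notation j := (jmx c).

Lemma jmul_jmul u : jmul c (jmul c u) = - u.
Proof. by rewrite /jmul mulmxA jmx_sqr mulNmx mul1mx. Qed.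

Lemma sinner_jmul u v : sinner (jmul c u) v = - sinner u (jmul c v).
Proof. exact/sinner_skew/jmx_skew. Qed.

Lemma jmul_cvec x u : jmul c (cl x *m u) = - (cl x *m jmul c u).
Proof. by rewrite /jmul mulmxA jmx_cvec mulNmx mulmxA. Qed.

Lemma sinner_cvec x u v : sinner (cl x *m u) v = - sinner u (cl x *m v).
Proof. exact/sinner_skew/cvec_skew. Qed.

(** Moving x across, anticommuting it with j and moving j back turns the product into its own
    negative. *)
Lemma sinner_cvec_jmul x u : sinner (cl x *m u) (jmul c u) = 0.
Proof.
have e : sinner (cl x *m u) (jmul c u) = - sinner (cl x *m u) (jmul c u).
  rewrite [LHS]sinner_cvec [in LHS]sinnerC -[in LHS]sinnerNl -jmul_cvec.
  by rewrite sinner_jmul.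
lra.
Qed.

Lemma sinner_cvec2 x y u :
  sinner (cl x *m u) (cl y *m u) = (x *m y^T) 0 0 * sinner u u.
Proof.
have e1 : sinner (cl x *m u) (cl y *m u) = - sinner u (cl x *m cl y *m u).
  by rewrite sinner_cvec mulmxA.
have e2 : sinner (cl x *m u) (cl y *m u) = - sinner u (cl y *m cl x *m u).
  by rewrite sinnerC sinner_cvec mulmxA.
have := congr1 (fun B => sinner u (B *m u)) (cvec_rel c x y).
by rewrite mulmxDl sinnerDr mul_scalar_mx sinnerZr => e3; lra.
Qed.

(** The columns are the spinors e_i u, so that x u, as a function of the vector x, becomes a matrix
    product. *)
Definition cliff_mx u : 'M[R]_(8, 6) := \matrix_(r, i) (cgen c i *m u) r 0.

Lemma cvec_mul x u : cl x *m u = cliff_mx u *m x^T.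
Proof.
rewrite /cvec mulmx_suml; apply/colP => r; rewrite mxE summxE.
by apply: eq_bigr => i _; rewrite -scalemxAl !mxE mulrC.
Qed.

Lemma cgen_mul i u : cgen c i *m u = cliff_mx u *m delta_mx i 0.
Proof. by rewrite -cvec_delta cvec_mul trmx_delta. Qed.

Lemma cliff_mx_tr u v i : ((cliff_mx u)^T *m v) i 0 = sinner (cgen c i *m u) v.
Proof. by rewrite cgen_mul /sinner trmx_mul trmx_delta -mulmxA -rowE [RHS]mxE. Qed.

Variable phi : 'cV[R]_8.
Hypothesis phi1 : sinner phi phi = 1.

Local Notation E := (cliff_mx phi).

Lemma sinner_mx u v : u^T *m v = (sinner u v)%:M.
Proof. exact: mx11_scalar. Qed.

Lemma cliff_mx_orth : E^T *m E = 1%:M.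
Proof.
apply/matrixP => i k; have -> : (E^T *m E) i k = (E^T *m (cgen c k *m phi)) i 0.
  by rewrite cgen_mul mulmxA -colE [RHS]mxE.
rewrite cliff_mx_tr -!cvec_delta sinner_cvec2 phi1 mulr1 trmx_delta mxE.
rewrite (bigD1 i) //= big1 ?addr0 => [|l li].
  by rewrite !mxE !eqxx mul1r andbT.
by rewrite !mxE (negbTE li) mul0r.
Qed.

Lemma cliff_mx_phi : E^T *m phi = 0.
Proof.
apply/colP => i; rewrite cliff_mx_tr -cvec_delta mxE.
exact/sinner_skew0/cvec_skew.
Qed.

Lemma cliff_mx_jphi : E^T *m jmul c phi = 0.
Proof. by apply/colP => i; rewrite cliff_mx_tr -cvec_delta sinner_cvec_jmul mxE. Qed.

(* The matrix with columns phi, j phi, e_1 phi, ..., e_6 phi is orthogonal. *)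
Lemma spinor_basis u :
  u = sinner phi u *: phi + sinner (jmul c phi) u *: jmul c phi + E *m (E^T *m u).
Proof.
pose f := jmul c phi.
have fphi : sinner f phi = 0 by exact/sinner_skew0/jmx_skew.
pose B := row_mx (row_mx phi f) E : 'M[R]_(8, 1 + 1 + 6).
have BB : B^T *m B = 1%:M.
  have Ef : E^T *m row_mx phi f = 0.
    by rewrite mul_mx_row cliff_mx_phi cliff_mx_jphi row_mx0.
  rewrite /B !tr_row_mx mul_col_row cliff_mx_orth Ef.
  have -> : col_mx phi^T f^T *m E = 0.
    by rewrite -tr_row_mx -[LHS]trmxK trmx_mul trmxK Ef trmx0.
  rewrite mul_col_row !sinner_mx phi1 sinnerC fphi [sinner f f]sinner_jmul.
  by rewrite jmul_jmul sinnerNr opprK phi1 raddf0 -!scalar_mx_block.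
(* Since 1 + 1 + 6 = 8, [B] is square and B B^T = 1 follows; applied to u, this is the expansion. *)
have := mulmx1C BB; rewrite /B !tr_row_mx !mul_row_col => e.
rewrite -[LHS]mul1mx -e !mulmxDl -!mulmxA !sinner_mx.
by rewrite !mul_mx_scalar -scalemxAr.
Qed.

Lemma spinor_eq0 u : sinner u phi = 0 -> sinner u (jmul c phi) = 0 ->
  (forall x, sinner u (cl x *m phi) = 0) -> u = 0.
Proof.
move=> u1 u2 u3; rewrite [u]spinor_basis sinnerC u1 sinnerC u2 !scale0r !add0r.
have -> : E^T *m u = 0; last by rewrite mulmx0.
by apply/colP => i; rewrite cliff_mx_tr sinnerC -cvec_delta u3 mxE.
Qed.

(** The matrix of j on the span of the e_i phi, acting on columns. On row vectors J is given in the
    frame by its transpose, that is, by its negative. *)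
Definition acs_mx : 'M[R]_6 := locked (E^T *m (j *m E)).

Lemma acs_mx_skew : acs_mx^T = - acs_mx.
Proof. by rewrite /acs_mx -lock !trmx_mul trmxK jmx_skew mulmxN mulNmx mulmxA. Qed.

(** As j e_i phi is orthogonal to phi and to j phi, its expansion involves only the e_k phi. *)
Lemma jmx_cliff_mx : j *m E = E *m acs_mx.
Proof.
apply/matrixP => r i; rewrite -[j *m E](mulmx1) -[E *m _]mulmx1.
suff e : j *m E *m delta_mx i (0 : 'I_1) = E *m acs_mx *m delta_mx i 0.
  by have := congr1 (fun B : 'cV_8 => B r 0) e; rewrite -!colE !mulmx1 !mxE.
rewrite /acs_mx -lock -!mulmxA -cgen_mul [LHS]spinor_basis.
rewrite -cvec_delta [sinner (jmul c phi) _]sinner_jmul jmul_jmul sinnerNr opprK.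
have -> : sinner phi (cl (delta_mx 0 i) *m phi) = 0.
  by rewrite sinnerC; exact/sinner_skew0/cvec_skew.
have -> : sinner phi (j *m (cl (delta_mx 0 i) *m phi)) = 0.
  by rewrite -[_ *m (_ *m _)]/(jmul c _) -[LHS]opprK -sinner_jmul sinnerC
     sinner_cvec_jmul oppr0.
by rewrite !scale0r !add0r.
Qed.

Lemma acs_mx_sqr : acs_mx *m acs_mx = - 1%:M.
Proof.
rewrite {1}/acs_mx -lock -!mulmxA -jmx_cliff_mx (mulmxA j j) jmx_sqr mulNmx.
by rewrite mul1mx mulmxN cliff_mx_orth.
Qed.

Section DiracVector.
(* [N i] plays the role of the covariant derivative of phi along e_i. *)
Variable N : 'I_6 -> 'cV[R]_8.

Let D := \sum_i cgen c i *m N i.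
Let S : 'M[R]_6 := \matrix_(i, k) sinner (N i) (cgen c k *m phi).

Lemma dirac_phi : sinner D phi = - \tr S.
Proof.
rewrite /D sinner_suml -sumrN; apply: eq_bigr => i _.
by rewrite -cvec_delta sinner_cvec cvec_delta mxE.
Qed.

(** Moving e_i to the right and past j gives (N_i, j e_i phi); column i of [acs_mx] expands j e_i
    phi in the e_k phi. *)
Lemma dirac_jphi : sinner D (jmul c phi) = \tr (S *m acs_mx).
Proof.
rewrite /D sinner_suml; apply: eq_bigr => i _.
rewrite -cvec_delta sinner_cvec -sinnerNr -jmul_cvec cvec_delta cgen_mul.
rewrite /jmul mulmxA jmx_cliff_mx -mulmxA -colE.
rewrite [E *m _](_ : _ = \sum_k acs_mx k i *: (cgen c k *m phi)); last first.
  apply/colP => r; rewrite mxE summxE; apply: eq_bigr => k _.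
  by rewrite !mxE mulrC.
rewrite sinner_sumr mxE; apply: eq_bigr => k _.
by rewrite sinnerZr [S i k]mxE mulrC.
Qed.

(* Moving e_i across j z in the second summand turns it into the first one. *)
Lemma codiff_dirac x :
  \sum_i (sinner (cgen c i *m N i) (jmul c (cl x *m phi)) +
          sinner (cgen c i *m phi) (jmul c (cl x *m N i))) =
  2 * sinner D (jmul c (cl x *m phi)) +
  2 * \sum_i x 0 i * sinner (N i) (jmul c phi).
Proof.
rewrite /D sinner_suml !mulr_sumr -big_split; apply: eq_bigr => i _ /=.
(* The scalar part of this Clifford relation produces the terms x_i (N_i, j phi). *)
have e : cgen c i *m (cl x *m N i) =
    - (cl x *m (cgen c i *m N i)) - (2 * x 0 i) *: N i.
  have dx : ((delta_mx 0 i : 'rV[R]_6) *m x^T) 0 0 = x 0 i by rewrite -rowE !mxE.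
  have := cvec_rel c (delta_mx 0 i) x; rewrite cvec_delta dx.
  move=> /(congr1 (fun B => B *m N i)); rewrite mulmxDl -!mulmxA mul_scalar_mx.
  by move/(canRL (addrK _)) ->; rewrite mulNr scaleNr addrC.
rewrite -cvec_delta in e *.
rewrite [X in _ + X = _]sinner_cvec -sinnerNr -jmul_cvec e.
rewrite /jmul mulmxDr !mulmxN -scalemxAr -!/(jmul c _).
have phij w : sinner phi (jmul c w) = - sinner w (jmul c phi).
  by rewrite sinnerC sinner_jmul.
rewrite sinnerDr !sinnerNr sinnerZr !phij.
rewrite [sinner (cl x *m _) _]sinner_cvec -[- sinner (_ *m N i) _]sinnerNr -jmul_cvec.
by ring.
Qed.

Lemma dirac_eq0 : (D = 0) <->
  [/\ \tr S = 0, \tr (S *m acs_mx) = 0 &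
    forall x, sinner D (jmul c (cl x *m phi)) = 0].
Proof.
rewrite -dirac_jphi -[\tr S]opprK -dirac_phi.
split=> [->|[/eqP + D2 D3]]; first by split=> [||x]; rewrite sinner0l ?oppr0.
rewrite oppr_eq0 => /eqP D1.
(* The third hypothesis tests D against j x phi, so it is j D that is shown to be orthogonal to the
   whole basis; a second j recovers -D. *)
have : jmul c D = 0.
  apply: spinor_eq0 => [||x]; rewrite sinner_jmul ?D2 ?D3 ?oppr0 //.
  by rewrite jmul_jmul sinnerNr opprK.
by move/(congr1 (jmul c)); rewrite jmul_jmul /jmul mulmx0 => /eqP;
  rewrite oppr_eq0 => /eqP.
Qed.

End DiracVector.

End UnitSpinor.

(** * Action of Spin(6) on spinors *)

Section Spin.
Variables (R : realType) (c : clifford_rep R) (h : 'M[R]_8).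
Hypothesis h_spin : is_spin c h.

(** A unit vector acts by a skew matrix of square -1, which is orthogonal. *)
Lemma spin_orth : h^T *m h = 1%:M.
Proof.
case: h_spin => s [_ s1 ->]; elim: s s1 => [|x s IHs] s1.
  by rewrite big_nil trmx1 mul1mx.
rewrite big_cons trmx_mul mulmxA -(mulmxA _ _ (cvec c x)) cvec_skew mulNmx.
rewrite cvec_sqr.
have -> : (x *m x^T) 0 0 = 1.
  by rewrite mxE -[RHS](s1 x) ?mem_head//; apply: eq_bigr => i _; rewrite mxE expr2.
rewrite rmorphN opprK mulmx1 IHs // => y ys; apply: s1.
by rewrite in_cons ys orbT.
Qed.

(** Each vector factor anticommutes with j, and the number of factors is even. *)
Lemma spin_jmx : h *m jmx c = jmx c *m h.
Proof.
case: h_spin => s [+ _ ->].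
suff -> : (\prod_(x <- s) cvec c x) *m jmx c =
    (-1) ^+ (odd (size s)) *: (jmx c *m \prod_(x <- s) cvec c x).
  by case: odd => // _; rewrite scale1r.
elim: s => [|x s IHs]; first by rewrite big_nil mul1mx mulmx1 scale1r.
rewrite big_cons -mulmxA IHs mulmxA jmx_cvec mulNmx -scalemxAr mulmxA.
by rewrite /= signrN scaleNr scalerN opprK.
Qed.

Lemma spin_sinner u v : sinner (h *m u) (h *m v) = sinner u v.
Proof. by rewrite sinner_mull mulmxA spin_orth mul1mx. Qed.

Lemma spin_jmul u : h *m jmul c u = jmul c (h *m u).
Proof. by rewrite /jmul mulmxA spin_jmx mulmxA. Qed.

End Spin.
(** * Torsion classes *)

Section TorsionClasses.
Variables (R : realType) (G G' J : 'M[R]_6).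
Hypothesis G_sym : G^T = G.
Hypothesis G_inv : G *m G' = 1%:M.
Hypothesis J_sqr : J *m J = - 1%:M.
Hypothesis J_skew : J *m G = - (G *m J^T).

Local Notation b := (fun v w : 'rV[R]_6 => (v *m G *m w^T) 0 0).

(** The adjoint for the scalar product with Gram matrix G, in the row-vector convention; [G'] is the
    inverse of G. *)
Definition gadj (S : 'M[R]_6) : 'M[R]_6 := G *m S^T *m G'.

Let G'_inv : G' *m G = 1%:M. Proof. exact: mulmx1C. Qed.

Let G'_sym : G'^T = G'.
Proof.
by rewrite -[LHS]mulmx1 -G_inv mulmxA -{1}G_sym -trmx_mul G_inv trmx1 mul1mx.
Qed.

Lemma gadj_is_linear : linear gadj.
Proof.
move=> a S T; rewrite /gadj linearP mulmxDr mulmxDl.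
by rewrite -scalemxAr -scalemxAl.
Qed.

HB.instance Definition _ :=
  GRing.isLinear.Build R 'M[R]_6 'M[R]_6 _ gadj gadj_is_linear.

Lemma gadjK S : gadj (gadj S) = S.
Proof.
rewrite /gadj !trmx_mul trmxK G_sym G'_sym !mulmxA G_inv mul1mx.
by rewrite -mulmxA G_inv mulmx1.
Qed.

Lemma gadjM S T : gadj (S *m T) = gadj T *m gadj S.
Proof.
by rewrite /gadj trmx_mul !mulmxA -[_ *m G' *m G]mulmxA G'_inv mulmx1.
Qed.

Lemma gadj_J : gadj J = - J.
Proof. by rewrite /gadj -[G *m _]opprK -J_skew mulNmx -mulmxA G_inv mulmx1. Qed.

Lemma mxtrace_gadj S : \tr (gadj S) = \tr S.
Proof. by rewrite /gadj mxtrace_mulC mulmxA G'_inv mul1mx mxtrace_tr. Qed.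

Lemma adjoint_mxP (S T : 'M[R]_6) :
  (forall v w : 'rV_6, (v *m S *m G *m w^T) 0 0 = (v *m T *m w^T) 0 0) <-> S *m G = T.
Proof.
split=> [e|<- v w]; last by rewrite mulmxA.
apply/matrixP => i k; have := e (delta_mx 0 i) (delta_mx 0 k).
by rewrite trmx_delta -!colE -mulmxA -!rowE !mxE.
Qed.

Lemma selfadjP S : selfadj b S <-> gadj S = S.
Proof.
rewrite /selfadj /gadj; transitivity (S *m G = G *m S^T).
  rewrite -adjoint_mxP; split=> e v w; rewrite /= in e *; rewrite e.
    by rewrite trmx_mul !mulmxA.
  by rewrite trmx_mul !mulmxA.
split=> [<-|e]; first by rewrite -mulmxA G_inv mulmx1.
by rewrite -{1}e -mulmxA G'_inv mulmx1.
Qed.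

Lemma skewadjP S : skewadj b S <-> gadj S = - S.
Proof.
rewrite /skewadj /gadj; transitivity (S *m G = - (G *m S^T)).
  rewrite -adjoint_mxP; split=> e v w; rewrite /= in e *; rewrite e.
    by rewrite trmx_mul mulmxN mulNmx [RHS]mxE !mulmxA.
  by rewrite trmx_mul mulmxN mulNmx [LHS]mxE !mulmxA.
split=> e; first by rewrite -[G *m _]opprK -e mulNmx -mulmxA G_inv mulmx1.
by rewrite -[X in X *m G]opprK -e mulNmx -(mulmxA _ G') G'_inv mulmx1.
Qed.

Lemma mxtrace_J : \tr J = 0.
Proof. by have := mxtrace_gadj J; rewrite gadj_J raddfN /= => ?; lra. Qed.

Lemma mxtrace_anticomm S : S *m J = - (J *m S) -> \tr (S *m J) = 0.
Proof.
by move=> e; have := mxtrace_mulC S J; rewrite e !raddfN /= => ?; lra.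
Qed.

(** Serves both splittings below: symmetric against skew, and commuting against anticommuting with
    J. *)
Lemma half_sub_add (V : lmodType R) (x y : V) :
  2^-1 *: (x - y) + 2^-1 *: (x + y) = x.
Proof.
rewrite -scalerDr addrACA addNr addr0 -[x + x]mulr2n -[x *+ 2]scaler_nat scalerA.
by rewrite mulVf ?scale1r ?pnatr_eq0.
Qed.

(* S is split into its G-symmetric and G-skew parts, and each of them into the
   parts commuting and anticommuting with J. *)
Lemma chi22bar345P t :
  chi22bar345 b J t <-> \tr t.1 = 0 /\ \tr (t.1 *m J) = 0.
Proof.
split.
  case=> t2 [t2b [t3 [t4 [t5 [[c2 c2b c3 c4 c5] ->]]]]].
  case: c2 => /skewadjP s2 _ j2 _; case: c2b => /selfadjP s2b r2b _ _.
  case: c3 => _ r3 /mxtrace_anticomm j3 _.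
  case: c4 => /skewadjP s4 /mxtrace_anticomm j4 _.
  (* A skew S is traceless. For a self-adjoint S, the adjoint of S J is -J S, so tr (S J) equals its
     own negative. *)
  have skew0 S : gadj S = - S -> \tr S = 0.
    by move=> e; have := mxtrace_gadj S; rewrite e raddfN /= => ?; lra.
  have j2b : \tr (t2b.1 *m J) = 0.
    have := mxtrace_gadj (t2b.1 *m J); rewrite gadjM s2b gadj_J mulNmx.
    by rewrite raddfN /= mxtrace_mulC => ?; lra.
  rewrite /= (c5 : t5.1 = 0) addr0 !mulmxDl !raddfD /= r2b r3 j2 j2b j3 j4.
  by rewrite (skew0 _ s2) (skew0 _ s4) !addr0.
case: t => S eta /= [trS trSJ].
pose sy : 'M[R]_6 := 2^-1 *: (S + gadj S).
pose sk : 'M[R]_6 := 2^-1 *: (S - gadj S).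
(* As J^2 = -1, averaging T with -J T J projects onto the matrices commuting with J, and averaging
   with J T J onto those anticommuting with J. *)
pose co (T : 'M[R]_6) : 'M[R]_6 := 2^-1 *: (T - J *m T *m J).
pose an (T : 'M[R]_6) : 'M[R]_6 := 2^-1 *: (T + J *m T *m J).
have gsy : gadj sy = sy by rewrite linearZ linearD /= gadjK addrC.
have gsk : gadj sk = - sk.
  by rewrite linearZ linearB /= gadjK -scalerN opprB.
have gJJ T : gadj (J *m T *m J) = J *m gadj T *m J.
  by rewrite !gadjM gadj_J mulNmx mulmxN mulmxN opprK mulmxA.
have gco T : gadj (co T) = co (gadj T) by rewrite linearZ linearB /= gJJ.
have gan T : gadj (an T) = an (gadj T) by rewrite linearZ linearD /= gJJ.
have coN T : co (- T) = - co T.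
  by rewrite /co mulmxN mulNmx -opprD scalerN.
have anN T : an (- T) = - an T.
  by rewrite /an mulmxN mulNmx -opprD scalerN.
have JJr T : T *m J *m J = - T by rewrite -mulmxA J_sqr mulmxN mulmx1.
have JJl T : J *m (J *m T) = - T by rewrite mulmxA J_sqr mulNmx mul1mx.
have coJ T : co T *m J = J *m co T.
  rewrite -scalemxAl -scalemxAr mulmxBl mulmxBr JJr -mulmxA JJl.
  by rewrite opprK opprK addrC.
have anJ T : an T *m J = - (J *m an T).
  rewrite -scalemxAl -scalemxAr mulmxDl mulmxDr JJr -mulmxA JJl.
  by rewrite -scalerN opprB addrC.
have trJJ T : \tr (J *m T *m J) = - \tr T.
  by rewrite mxtrace_mulC mulmxA J_sqr mulNmx mul1mx raddfN.
have coan T : co T + an T = T.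
  exact: half_sub_add.
have sysk : sy + sk = S.
  by rewrite addrC; exact: half_sub_add.
have trgJ : \tr (gadj S *m J) = 0.
  rewrite -mxtrace_gadj gadjM gadjK gadj_J mulNmx raddfN /=.
  by rewrite mxtrace_mulC trSJ oppr0.
(* All of eta goes to chi_5. The hypothesis on tr (S J) serves the chi_2 part, the one on tr S the
   chi_2bar part. *)
exists (co sk, 0), (co sy, 0), (an sy, 0), (an sk, 0), (0, eta); split; last first.
  transitivity (co sk + co sy + an sy + an sk + 0, 0 + 0 + 0 + 0 + eta); last by [].
  by rewrite !add0r addr0 -addrA [an sy + _]addrC addrACA !coan addrC sysk.
split; rewrite /chi2 /chi2bar /chi3 /chi4 /chi5 /=.
- split=> //; first by apply/skewadjP; rewrite gco gsk coN.
  rewrite -scalemxAl linearZ /= mulmxBl raddfB /= JJr raddfN /=.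
  rewrite [\tr (J *m sk)]mxtrace_mulC /sk -scalemxAl linearZ /= mulmxBl raddfB /=.
  by rewrite trSJ trgJ; lra.
- split=> //; first by apply/selfadjP; rewrite gco gsy.
  rewrite linearZ raddfB /= trJJ linearZ raddfD /= mxtrace_gadj trS; lra.
- split=> //; first by apply/selfadjP; rewrite gan gsy.
  rewrite linearZ raddfD /= trJJ; lra.
- by split=> //; apply/skewadjP; rewrite gan gsk anN.
- by [].
Qed.

(** Removing the two components must leave a pair on which both traces vanish. As tr J = 0, tr (J J)
    = -6 and tr Id = 6, the two conditions decouple and fix l and m. *)
Lemma chi1_componentsP t (l m : R) :
  chi1_components b J t (l *: J, 0) (m%:M, 0) <->
  l = - 6^-1 * \tr (t.1 *m J) /\ m = 6^-1 * \tr t.1.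
Proof.
have trJJ : \tr (J *m J) = - 6 by rewrite J_sqr raddfN /= mxtrace1.
transitivity (chi22bar345 b J (t - ((l *: J, 0) + (m%:M, 0)))).
  split=> [[_ _ [s chis ->]]|chis]; first by rewrite addrAC subrr add0r.
  split; [by split=> //; exists l | by split=> //; exists m |].
  by exists (t - ((l *: J, 0) + (m%:M, 0))) => //; rewrite addrC subrK.
rewrite chi22bar345P /= opprD !addrA !mulmxBl !raddfB /= -scalemxAl !mxtraceZ.
rewrite trJJ mul_scalar_mx mxtraceZ mxtrace_J mxtrace_scalar -[m *+ 6]mulr_natl.
split=> -[]; [move=> e1 e2|move=> -> ->]; split; lra.
Qed.

End TorsionClasses.
(** * Derivatives of functions and fields on the manifold *)

Section DirectionalDerivatives.
Variables (R : realType) (V : normedModType R).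
Implicit Types (U : set 'rV[R]_6) (f h : 'rV[R]_6 -> V).

(** The first-order expansion of f at x is also one of h, since both have the same germ. *)
Lemma near_eq_differentiable f h x :
  (\near x, f x = h x) -> differentiable f x -> differentiable h x.
Proof.
move=> fh /diff_locallyP [dfc fE].
have hE : h \o shift x = cst (h x) + 'd f x +o_ 0 id.
  apply/eqaddoP => e e0; have /eqaddoP/(_ e e0) fe := fE.
  have fh0 : \forall y \near 0, f (y + x) = h (y + x).
    by move: fh; rewrite (near_shift 0) /= subr0.
  apply: filterS2 fh0 fe => y fhy.
  by rewrite !fctE /= fhy (nbhs_singleton fh).
by apply/diff_locallyP; rewrite (diff_unique dfc hE).
Qed.

(** Charts are inverted only on their domains, so expressions in coordinates agree only on an open
    set; there their derivatives agree as well. *)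
Lemma Ck_on_eq k U f h : open U -> (forall x, U x -> f x = h x) ->
  Ck_on k U f -> Ck_on k U h.
Proof.
have near_eq (T : Type) (f0 h0 : 'rV[R]_6 -> T) x :
    open U -> (forall x, U x -> f0 x = h0 x) -> U x -> \near x, f0 x = h0 x.
  move=> oU fh Ux; apply: (filterS (P := U)); first exact: fh.
  exact: open_nbhs_nbhs.
elim: k f h => [|k IHk] f h oU fh /=.
  move=> cf x Ux; have e := near_eq _ _ _ _ oU fh Ux.
  rewrite /prop_for /continuous_at -(fh _ Ux).
  apply: cvg_trans (cf x Ux).
  exact: (@near_eq_cvg _ _ (nbhs x) _ f h e).
move=> [df Dkf]; split=> [x Ux|v].
  have e := near_eq _ _ _ _ oU fh Ux.
  exact: near_eq_differentiable e (df x Ux).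
apply: IHk (Dkf v) => // x Ux; apply: near_eq_derive.
exact: near_eq.
Qed.

Lemma Ck_on_scaleD k U f h (a : R) : open U -> Ck_on k U f -> Ck_on k U h ->
  Ck_on k U (fun x => a *: f x + h x).
Proof.
elim: k f h => [|k IHk] f h oU /=.
  move=> cf ch x Ux; have ca : {for x, continuous (fun _ : 'rV[R]_6 => a)}.
    exact: cst_continuous.
  exact: continuousD (continuousZ ca (cf x Ux)) (ch x Ux).
move=> [df Dkf] [dh Dkh]; split=> [x Ux|v].
  by apply: differentiableD (dh x Ux); apply: differentiableZ; exact: df.
apply: Ck_on_eq (IHk _ _ oU (Dkf v) (Dkh v)) => // x Ux.
have dfx : derivable f x v by apply: diff_derivable; exact: df.
have dhx : derivable h x v by apply: diff_derivable; exact: dh.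
rewrite [RHS](_ : _ = 'D_v (a *: f + h) x) // deriveD ?deriveZ //.
exact: derivableZ.
Qed.

Lemma derive_scaleD f x (a : R) v w : differentiable f x ->
  'D_(a *: v + w) f x = a *: 'D_v f x + 'D_w f x.
Proof. by move=> df; rewrite !deriveE // linearP. Qed.

End DirectionalDerivatives.

Lemma Ck_on_cst (R : realType) (V : normedModType R) k U (a : V) :
  Ck_on k U (fun _ : 'rV[R]_6 => a).
Proof.
elim: k a => [|k IHk] a /=; first by move=> x _; exact: cst_continuous.
split=> [x _|v]; first exact: differentiable_cst.
under eq_fun do rewrite derive_cst.
exact: IHk.
Qed.

(** The Leibniz rule for a quadratic form, obtained entrywise. It is applied with B = 1 to |phi|^2
    and with B = -y j z to omega. *)
Lemma derive_sinner (R : realType) (B : 'M[R]_8)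
    (f : 'rV[R]_6 -> 'cV[R]_8) x v : derivable f x v ->
  'D_v (fun y => sinner (f y) (B *m f y) : R^o) x =
  sinner ('D_v f x) (B *m f x) + sinner (f x) (B *m 'D_v f x).
Proof.
move=> df; have dfi i := (derivable_mxP f x v).1 df i 0.
have E y : sinner (f y) (B *m f y) =
    (\sum_i \sum_k (fun z => f z i 0 * B i k * f z k 0)) y.
  rewrite /sinner mxE fct_sumE; apply: eq_bigr => i _.
  rewrite fct_sumE !mxE mulr_sumr; apply: eq_bigr => k _.
  by rewrite mulrA.
rewrite (_ : (fun y => _) = \sum_i \sum_k (fun z => f z i 0 * B i k * f z k 0));
  last exact/funext.
have dterm i k : is_derive x v (fun z => f z i 0 * B i k * f z k 0 : R^o)
    (f x i 0 * B i k * ('D_v f x) k 0 + ('D_v f x) i 0 * B i k * f x k 0).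
  have di := derivableP (dfi i); have dk := derivableP (dfi k).
  apply: is_derive_eq.
  by rewrite !(derive_mx df) !mxE scaler0 add0r /GRing.scale /=; ring.
have dsum := is_derive_sum (fun i => is_derive_sum (fun k => dterm i k)).
rewrite derive_val /sinner !mxE -big_split; apply: eq_bigr => i _.
rewrite !mxE !mulr_sumr -big_split; apply: eq_bigr => k _ /=.
by rewrite addrC !mulrA.
Qed.

(** * Locality and linearity of derivatives on the manifold *)

Section Manifold.
Variables (R : realType) (M : topologicalType) (A : manifold6 R M).
Variable V : normedModType R.
Implicit Types (U W : set M) (f h : M -> V).

(** Near the image of a point of W, coordinates stay in the open chart image and, by continuity of
    [param], come from W. *)
Lemma coord_image_open (a : chart A) W : open W ->
  open (Defs.coord a @` (dom a `&` W)).
Proof.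
move=> oW; rewrite openE => _ [q [aq Wq] <-].
have oa : nbhs (Defs.coord a q) (Defs.coord a @` dom a).
  by apply: open_nbhs_nbhs; split; [exact: coord_dom_open|exists q].
have oW' : nbhs (Defs.coord a q) (param a @^-1` W).
  apply: param_continuous; first by exists q.
  by rewrite coordK //; apply: open_nbhs_nbhs.
rewrite /interior; apply: filterS2 oa oW' => _ [r ar <-] /=.
by rewrite coordK // => Wr; exists r.
Qed.

Lemma smooth_differentiable U f p : smooth A U f -> U p ->
  differentiable (f \o param (chart_at A p)) (Defs.coord (chart_at A p) p).
Proof.
move=> /(_ (chart_at A p) 1) [+ _] Up; apply.
by exists p => //; split=> //; exact: dom_chart_at.
Qed.

Lemma der_near U f h p v : open U -> U p -> (forall q, U q -> f q = h q) ->
  der A p v f = der A p v h.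
Proof.
move=> oU Up fh; apply: near_eq_derive.
have Pp := @coord_image_open (chart_at A p) _ oU.
apply: filterS (open_nbhs_nbhs (conj Pp _)).
  by move=> _ [q [aq Uq] <-] /=; rewrite coordK // fh.
by exists p => //; split=> //; exact: dom_chart_at.
Qed.

Lemma der_scaleD U f p (a : R) v w : smooth A U f -> U p ->
  der A p (a *: v + w) f = a *: der A p v f + der A p w f.
Proof. by move=> sf Up; apply/derive_scaleD/smooth_differentiable/Up/sf. Qed.

Lemma der_cst p v (a : V) : der A p v (fun=> a) = 0.
Proof. exact: derive_cst. Qed.

Lemma smooth_cst U (a : V) : smooth A U (fun=> a).
Proof. by move=> b k; exact: Ck_on_cst. Qed.

End Manifold.

(** * Linear combinations of vector fields and their covariant derivatives *)

Section VectorFields.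
Variables (R : realType) (M : topologicalType) (A : manifold6 R M).
Variables (g : metric A) (nb : levi_civita g).
Implicit Types (U : set M) (X Y : vfield R M).

(** Smoothness of a field is tested on functions, where the combination acts by linearity of the
    derivative in its direction. *)
Lemma smooth_vf_scaleD U X Y (a : R) : smooth_vf A U X -> smooth_vf A U Y ->
  smooth_vf A U (fun q => a *: X q + Y q).
Proof.
move=> sX sY W f oW WU sf b k.
apply: Ck_on_eq (Ck_on_scaleD a _ (sX W f oW WU sf b k) (sY W f oW WU sf b k)).
- exact: coord_image_open.
- by move=> _ [q [bq Wq] <-] /=; rewrite coordK // (der_scaleD _ _ _ sf).
- exact: coord_image_open.
Qed.

Lemma smooth_vf0 U : smooth_vf A U (fun=> 0).
Proof.
move=> W f oW WU sf; rewrite (_ : (fun _ => _) = fun=> 0); last first.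
  by apply/funext => q; exact: derive0.
exact: smooth_cst.
Qed.

Lemma nabla_scale U Y p v (a : R) : open U -> U p -> smooth_vf A U Y ->
  nabla nb (fun q => a *: Y q) p v = a *: nabla nb Y p v.
Proof.
move=> oU Up sY; have /= := nabla_leibniz nb v oU Up (@smooth_cst _ _ A _ U (a : R^o)) sY.
by move=> ->; rewrite der_cst scale0r add0r.
Qed.

(** Smoothness is carried through the induction because additivity of [nabla] demands it of the
    tail. *)
Lemma nabla_lincomb U p v (I : Type) (r : seq I) (a : I -> R)
    (X : I -> vfield R M) : open U -> U p -> (forall i, smooth_vf A U (X i)) ->
  smooth_vf A U (fun q => \sum_(i <- r) a i *: X i q) /\
  nabla nb (fun q => \sum_(i <- r) a i *: X i q) p v =
  \sum_(i <- r) a i *: nabla nb (X i) p v.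
Proof.
move=> oU Up sX; elim: r => [|i r [sr IHr]].
  rewrite big_nil; under eq_fun do rewrite big_nil.
  split; first exact: smooth_vf0.
  have := nabla_scale v 0 oU Up (@smooth_vf0 U); rewrite [RHS]scale0r => e.
  by rewrite -[RHS]e scale0r.
rewrite big_cons; under eq_fun do rewrite big_cons.
split; first exact: smooth_vf_scaleD.
have siX : smooth_vf A U (fun q => a i *: X i q).
  under eq_fun do rewrite -[_ *: _]addr0.
  by apply: smooth_vf_scaleD => //; exact: smooth_vf0.
by rewrite (nabla_add nb v oU Up) // IHr (nabla_scale v (a i) oU Up).
Qed.

End VectorFields.
(** * The spin connection and the torsion of a unit spinor field *)

Section SpinConnection.
Variables (R : realType) (c : clifford_rep R) (Gam : 'M[R]_6).

(** The image of a skew matrix under the isomorphism of so(6) with the Lie algebra of Spin(6), as an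
    operator on spinors. *)
Definition spin_conn : 'M[R]_8 :=
  2^-1 *: \sum_(a < 6) \sum_(b < 6 | (a < b)%N) Gam a b *: (cgen c a *m cgen c b).

(** The transpose of e_a e_b is e_b e_a, which is -e_a e_b because a < b. *)
Lemma spin_conn_skew : spin_conn^T = - spin_conn.
Proof.
rewrite /spin_conn linearZ /= -scalerN; congr (_ *: _).
rewrite linear_sum -sumrN; apply: eq_bigr => a _.
rewrite linear_sum -sumrN; apply: eq_bigr => b ab.
rewrite linearZ /= trmx_mul !cgen_skew mulmxN mulNmx opprK -scalerN.
congr (_ *: _); apply/eqP; rewrite -addr_eq0 cgen_rel.
have /negbTE -> : b != a by apply: contraTneq ab => ->; rewrite ltnn.
by rewrite oppr0 mul0rn raddf0.
Qed.

Lemma spin_conn_jmx : jmx c *m spin_conn = spin_conn *m jmx c.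
Proof.
rewrite /spin_conn -scalemxAr -scalemxAl; congr (_ *: _).
rewrite mulmx_sumr mulmx_suml; apply: eq_bigr => a _.
rewrite mulmx_sumr mulmx_suml; apply: eq_bigr => b _.
rewrite -scalemxAr -scalemxAl mulmxA jmx_cgen mulNmx -!mulmxA jmx_cgen.
by rewrite mulmxN opprK.
Qed.

Hypothesis Gam_skew : Gam^T = - Gam.

(** The commutator of e_a e_b with e_k is 2 (delta_ak e_b - delta_bk e_a). Summed over a < b it
    yields row k right of the diagonal and minus column k above it; skewness of [Gam] joins them
    into the whole row. *)
Lemma spin_conn_cgen k :
  spin_conn *m cgen c k - cgen c k *m spin_conn = \sum_b Gam k b *: cgen c b.
Proof.
(* Truncating to the upper triangle lets the sums run over all pairs, so that the Kronecker deltas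
   can be contracted. *)
pose G (a b : 'I_6) := if (a < b)%N then Gam a b else 0.
have comm a b : cgen c a *m cgen c b *m cgen c k -
    cgen c k *m (cgen c a *m cgen c b) =
    2 *: ((a == k)%:R *: cgen c b - (b == k)%:R *: cgen c a).
  have e1 : cgen c b *m cgen c k = (- (b == k)%:R *+ 2)%:M - cgen c k *m cgen c b.
    by rewrite -(cgen_rel c b k) addrK.
  have e2 : cgen c k *m cgen c a = (- (a == k)%:R *+ 2)%:M - cgen c a *m cgen c k.
    by rewrite -(cgen_rel c a k) addrC addKr.
  rewrite -mulmxA e1 mulmxA e2 mulmxBr mulmxBl mul_mx_scalar mul_scalar_mx.
  rewrite mulmxA opprB subrKA addrC scalerBr !scalerA !mulNrn !scaleNr opprK.
  by rewrite -[_ *+ 2]mulr_natl -[_%:R *+ 2]mulr_natl.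
transitivity (\sum_a \sum_b
    G a b *: ((a == k)%:R *: cgen c b - (b == k)%:R *: cgen c a)).
  rewrite /spin_conn -scalemxAl -scalemxAr -scalerBr.
  rewrite mulmx_suml mulmx_sumr -sumrB scaler_sumr; apply: eq_bigr => a _.
  rewrite mulmx_suml mulmx_sumr -sumrB big_mkcond scaler_sumr.
  apply: eq_bigr => b _ /=; rewrite /G.
  case: ifP => _; last by rewrite scaler0 scale0r.
  rewrite -scalemxAl -scalemxAr -scalerBr comm !scalerA.
  by congr (_ *: _); field.
have e1 : \sum_a \sum_b G a b *: ((a == k)%:R *: cgen c b) =
    \sum_b G k b *: cgen c b.
  rewrite (bigD1 k) //= [X in _ + X]big1 ?addr0 => [|a ak].
    by apply: eq_bigr => b _; rewrite eqxx scale1r.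
  by apply: big1 => b _; rewrite (negbTE ak) scale0r scaler0.
have e2 : \sum_a \sum_b G a b *: ((b == k)%:R *: cgen c a) =
    \sum_a G a k *: cgen c a.
  apply: eq_bigr => a _; rewrite (bigD1 k) //= big1 ?addr0 => [|b bk].
    by rewrite eqxx scale1r.
  by rewrite (negbTE bk) scale0r scaler0.
under eq_bigr do under eq_bigr do rewrite scalerBr.
under eq_bigr do rewrite sumrB.
rewrite sumrB e1 e2 -sumrB; apply: eq_bigr => b _.
have sk i l : Gam i l = - Gam l i.
  by have /matrixP/(_ l i) := Gam_skew; rewrite !mxE.
rewrite -scalerBl /G; congr (_ *: _).
case: (ltngtP k b) => [_|_|/val_inj ->]; rewrite ?subr0 ?sub0r //.
by have := sk b b; lra.
Qed.

Lemma spin_conn_cvec x :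
  spin_conn *m cvec c x = cvec c x *m spin_conn + cvec c (x *m Gam).
Proof.
apply/eqP; rewrite addrC -subr_eq; apply/eqP.
transitivity (\sum_k x 0 k *: \sum_b Gam k b *: cgen c b).
  rewrite /cvec mulmx_sumr mulmx_suml -sumrB; apply: eq_bigr => k _.
  by rewrite -scalemxAl -scalemxAr -scalerBr spin_conn_cgen.
under eq_bigr do rewrite scaler_sumr.
rewrite exchange_big; apply: eq_bigr => b _ /=.
by rewrite mxE scaler_suml; apply: eq_bigr => k _; rewrite scalerA.
Qed.

End SpinConnection.

(** * Orthonormal frames and changes of gauge *)

Section Frames.
Variables (R : realType) (M : topologicalType) (A : manifold6 R M).
Variables (g : metric A) (c : clifford_rep R) (sp : spin_structure g c).
Implicit Types (k l : gauge sp) (p q : M) (v w : 'rV[R]_6).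

Definition frame_mx k q : 'M[R]_6 := \matrix_i frame k i q.

(** Sends a tangent vector to its components in the frame; on [gdom k] it is the inverse of
    [frame_mx]. *)
Definition coframe_mx k q : 'M[R]_6 :=
  locked (gram g q *m (frame_mx k q)^T).

Lemma frame_coordE k q v :
  \row_i inner g q v (frame k i q) = v *m coframe_mx k q.
Proof.
apply/rowP => i; rewrite mxE /inner /coframe_mx -lock mulmxA.
by rewrite [RHS]mxE [LHS]mxE; apply: eq_bigr => b _; rewrite !mxE.
Qed.

Lemma innerC p v w : inner g p v w = inner g p w v.
Proof.
rewrite /inner -[v *m _ *m _]trmxK [LHS]mxE !trmx_mul trmxK gram_sym.
by rewrite mulmxA.
Qed.

Lemma frame_mx_row k q i : delta_mx 0 i *m frame_mx k q = frame k i q.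
Proof. by rewrite -rowE rowK. Qed.

Lemma row_frame_mx k q (x : 'rV[R]_6) :
  x *m frame_mx k q = \sum_i x 0 i *: frame k i q.
Proof. by rewrite mulmx_sum_row; apply: eq_bigr => i _; rewrite rowK. Qed.

Lemma frame_coframe k q : gdom k q -> frame_mx k q *m coframe_mx k q = 1%:M.
Proof.
move=> kq; apply/row_matrixP => i; rewrite row_mul rowK -frame_coordE.
by apply/rowP => i'; rewrite !mxE frame_orthonormal.
Qed.

Lemma coframe_frame k q : gdom k q -> coframe_mx k q *m frame_mx k q = 1%:M.
Proof. by move=> /frame_coframe /mulmx1C. Qed.

Lemma gram_inv k q : gdom k q ->
  gram g q *m ((frame_mx k q)^T *m frame_mx k q) = 1%:M.
Proof. by move=> kq; rewrite mulmxA -(coframe_frame kq) /coframe_mx -lock. Qed.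

Lemma coframe_gram k q : gdom k q ->
  coframe_mx k q *m (coframe_mx k q)^T = gram g q.
Proof.
move=> kq; rewrite {2}/coframe_mx -lock trmx_mul trmxK gram_sym mulmxA.
by rewrite coframe_frame // mul1mx.
Qed.

Lemma inner_coframe k q v w : gdom k q ->
  inner g q v w = (v *m coframe_mx k q *m (w *m coframe_mx k q)^T) 0 0.
Proof.
by move=> kq; rewrite /inner -(coframe_gram kq) (trmx_mul w) !mulmxA.
Qed.

Lemma frame_coord_delta k q i : gdom k q ->
  frame k i q *m coframe_mx k q = delta_mx 0 i.
Proof. by move=> kq; rewrite -frame_mx_row -mulmxA frame_coframe // mulmx1. Qed.

(** Extends [spin_lift] from the frame vectors to all tangent vectors by linearity. *)
Lemma slift_cvec k l q v : gdom k q -> gdom l q ->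
  slift k l q *m cvec c (v *m coframe_mx l q) =
  cvec c (v *m coframe_mx k q) *m slift k l q.
Proof.
move=> kq lq; set x := v *m coframe_mx l q.
have -> : v = x *m frame_mx l q by rewrite -mulmxA coframe_frame // mulmx1.
rewrite row_frame_mx [_ *m coframe_mx k q]mulmx_suml [X in _ = X *m _]linear_sum mulmx_suml.
rewrite [X in _ *m X = _]/cvec mulmx_sumr.
apply: eq_bigr => i _; rewrite -scalemxAr spin_lift // -scalemxAl linearZ /=.
rewrite -scalemxAl; congr (_ *: (_ *m _)); rewrite -frame_coordE /cvec.
by apply: eq_bigr => i' _; rewrite mxE.
Qed.

(** The cocycle condition makes it idempotent, and it is invertible since orthogonal. *)
Lemma slift_id k q : gdom k q -> slift k k q = 1%:M.
Proof.
move=> kq; have h1 := spin_orth (lift_spin kq kq).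
have := congr1 (mulmx (slift k k q)^T) (lift_cocycle kq kq kq).
by rewrite mulmxA h1 mul1mx.
Qed.

Lemma cmulE p v u :
  cmul sp p v u = cvec c (v *m coframe_mx (gauge_at sp p) p) *m u.
Proof. by rewrite /cmul frame_coordE. Qed.

Lemma cmul_frame p i u : cmul sp p (frame (gauge_at sp p) i p) u = cgen c i *m u.
Proof.
by rewrite cmulE frame_coord_delta ?cvec_delta //; exact: gdom_gauge_at.
Qed.

End Frames.

(** * Almost complex structure, torsion, codifferential and Dirac operator of a unit spinor field *)

Section SpinorField.
Variables (R : realType) (M : topologicalType) (A : manifold6 R M).
Variables (g : metric A) (c : clifford_rep R) (sp : spin_structure g c).
Variables (nb : levi_civita g) (phi : sfield R M).
Hypothesis phi_unit : unit_spinor_field sp phi.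
Implicit Types (k : gauge sp) (p q : M) (v w : 'rV[R]_6).

Let phi1 p : sinner (phi p) (phi p) = 1.
Proof. by case: phi_unit. Qed.

Local Notation fr p := (frame (gauge_at sp p)).
Local Notation P p := (coframe_mx (gauge_at sp p) p).
Local Notation F p := (frame_mx (gauge_at sp p) p).
Local Notation E p := (cliff_mx c (phi p)).
Local Notation K p := (acs_mx c (phi p)).
Local Notation dom_at p := (gdom_gauge_at sp p).

Lemma in_gauge_unit k q : gdom k q ->
  sinner (in_gauge k phi q) (in_gauge k phi q) = 1.
Proof. by move=> kq; rewrite (spin_sinner (lift_spin kq (dom_at q))). Qed.

Lemma in_gauge_at p : in_gauge (gauge_at sp p) phi p = phi p.
Proof. by rewrite /in_gauge slift_id ?mul1mx //; exact: gdom_gauge_at. Qed.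

(** Since [acs] is selected by [get], both existence and uniqueness are shown; uniqueness comes from
    injectivity of v -> v phi. The sign is that of the transpose of the skew matrix [acs_mx]. *)
Lemma acsE q : acs sp phi q = - (P q *m K q *m F q).
Proof.
have FP := frame_coframe (dom_at q); have PF := coframe_frame (dom_at q).
have jE v : jmul c (cmul sp q v (phi q)) = E q *m (K q *m (v *m P q)^T).
  by rewrite cmulE cvec_mul /jmul mulmxA jmx_cliff_mx // mulmxA.
have cE v (J : 'M[R]_6) :
    cmul sp q (v *m J) (phi q) = E q *m (v *m J *m P q)^T.
  by rewrite cmulE cvec_mul.
apply: get_unique => [v|J Jphi] /=.
  rewrite cE jE mulmxN mulNmx -!mulmxA FP mulmx1 -!mulmxN -acs_mx_skew.
  by rewrite !trmx_mul trmxK !mulmxA.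
have e : J *m P q = - (P q *m K q).
  apply/row_matrixP => i; have := Jphi (delta_mx 0 i); rewrite cE jE.
  move=> /(congr1 (mulmx (E q)^T)); rewrite !mulmxA cliff_mx_orth // !mul1mx.
  move=> /(congr1 trmx); rewrite trmxK trmx_mul trmxK acs_mx_skew mulmxN.
  by rewrite !rowE mulmxN !mulmxA.
by rewrite -[J]mulmx1 -PF mulmxA e mulNmx.
Qed.

Lemma acsP q v :
  cmul sp q (v *m acs sp phi q) (phi q) = jmul c (cmul sp q v (phi q)).
Proof.
rewrite acsE !cmulE !cvec_mul /jmul !mulmxA jmx_cliff_mx // mulmxN mulNmx.
rewrite -!mulmxA (frame_coframe (dom_at q)) mulmx1 -!mulmxN -acs_mx_skew.
by rewrite !trmx_mul trmxK !mulmxA.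
Qed.

Lemma acs_sqr q : acs sp phi q *m acs sp phi q = - 1%:M.
Proof.
rewrite acsE mulmxN mulNmx opprK -!mulmxA (mulmxA (F q)).
rewrite (frame_coframe (dom_at q)) mul1mx (mulmxA (K q)) acs_mx_sqr //.
by rewrite mulNmx mul1mx mulmxN (coframe_frame (dom_at q)).
Qed.

Lemma acs_skew q :
  acs sp phi q *m gram g q = - (gram g q *m (acs sp phi q)^T).
Proof.
have FP := frame_coframe (dom_at q).
rewrite acsE -(coframe_gram (dom_at q)) raddfN /= mulmxN opprK mulNmx.
rewrite !(trmx_mul, trmxK) -!mulmxA (mulmxA (F q)) FP mul1mx.
rewrite (mulmxA (P q)^T) -(trmx_mul (F q)) FP trmx1 mul1mx acs_mx_skew.
by rewrite mulNmx mulmxN.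
Qed.

(** The gauge identifying the fibre at q varies with q. Gauge changes are orthogonal and commute
    with j, so one fixed gauge around p may be used, where omega can be differentiated. *)
Lemma omega_in_gauge k q v w : gdom k q ->
  omega sp phi q v w =
  sinner (cvec c (v *m coframe_mx k q) *m in_gauge k phi q)
         (jmul c (cvec c (w *m coframe_mx k q) *m in_gauge k phi q)).
Proof.
move=> kq; have hs := lift_spin kq (dom_at q).
have hc u : cvec c (u *m coframe_mx k q) *m in_gauge k phi q =
    slift k (gauge_at sp q) q *m cmul sp q u (phi q).
  by rewrite cmulE /in_gauge mulmxA -(slift_cvec _ kq (dom_at q)) mulmxA.
rewrite !hc -(spin_jmul hs) (spin_sinner hs) -acsP !cmulE sinner_cvec2 phi1 mulr1.
by rewrite /omega (inner_coframe _ _ (dom_at q)).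
Qed.

Definition conn_mx p v : 'M[R]_6 :=
  \matrix_(a, b) inner g p (nabla nb (fr p a) p v) (fr p b p).

(** Differentiate the orthonormality relations of the frame. *)
Lemma conn_mx_skew p v : (conn_mx p v)^T = - conn_mx p v.
Proof.
have oU := gdom_open (gauge_at sp p); have Up := dom_at p.
have sm i := @frame_smooth _ _ _ _ _ sp (gauge_at sp p) i.
apply/matrixP => a b; rewrite !mxE; apply/eqP; rewrite -addr_eq0; apply/eqP.
have := nabla_metric nb v oU Up (sm b) (sm a).
rewrite (der_near A (h := fun=> (b == a)%:R : R^o) v oU Up); last first.
  by move=> q Uq; rewrite frame_orthonormal.
by rewrite der_cst [X in _ + X]innerC => <-.
Qed.

Lemma snablaE p v : snabla sp nb phi p v =
  der A p v (in_gauge (gauge_at sp p) phi) + spin_conn c (conn_mx p v) *m phi p.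
Proof.
rewrite /snabla /spin_conn -scalemxAl; congr (_ + _ *: _).
rewrite mulmx_suml; apply: eq_bigr => a _.
rewrite mulmx_suml; apply: eq_bigr => b _.
by rewrite !cmul_frame mxE -scalemxAl mulmxA.
Qed.

Lemma in_gauge_derivable p v :
  derivable (in_gauge (gauge_at sp p) phi \o param (chart_at A p))
    (Defs.coord (chart_at A p) p) v.
Proof.
apply: diff_derivable.
exact: (smooth_differentiable (phi_unit.1 (gauge_at sp p)) (dom_at p)).
Qed.

Lemma in_gauge_param p :
  in_gauge (gauge_at sp p) phi (param (chart_at A p) (Defs.coord (chart_at A p) p))
  = phi p.
Proof. by rewrite coordK ?in_gauge_at //; exact: dom_chart_at. Qed.

(** Differentiate |phi|^2 = 1 in a gauge; the spin connection drops out by skewness. *)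
Lemma snabla_phi p v : sinner (snabla sp nb phi p v) (phi p) = 0.
Proof.
rewrite snablaE sinnerDl (sinner_skew0 _ (spin_conn_skew _ _)) addr0.
have := der_cst A p v (1 : R^o).
rewrite -(der_near A (f := fun q => sinner (in_gauge (gauge_at sp p) phi q)
  (1%:M *m in_gauge (gauge_at sp p) phi q)) v (gdom_open (gauge_at sp p)) (dom_at p));
  last by move=> q Uq; rewrite mul1mx in_gauge_unit.
rewrite /der (derive_sinner _ (@in_gauge_derivable p v)) !mul1mx /= in_gauge_param.
by rewrite [X in _ + X]sinnerC -/(der _ _ _ _) => ?; lra.
Qed.

Lemma snabla_linear p (a : R) v w : snabla sp nb phi p (a *: v + w) =
  a *: snabla sp nb phi p v + snabla sp nb phi p w.
Proof.
have oU := gdom_open (gauge_at sp p); have Up := dom_at p.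
have sm i := @frame_smooth _ _ _ _ _ sp (gauge_at sp p) i.
rewrite !snablaE (der_scaleD _ _ _ (phi_unit.1 (gauge_at sp p)) Up).
rewrite scalerDr addrACA; congr (_ + _); rewrite scalemxAl -mulmxDl.
congr (_ *m _); rewrite /spin_conn scalerA mulrC -scalerA -scalerDr.
congr (_ *: _); rewrite scaler_sumr -big_split; apply: eq_bigr => i _ /=.
rewrite scaler_sumr -big_split; apply: eq_bigr => l _ /=.
rewrite scalerA -scalerDl !mxE (nabla_linear nb oU Up (sm i)).
by rewrite /inner !mulmxDl -!scalemxAl !mxE.
Qed.

(** As [torsion] is selected by [get], it suffices to exhibit one pair. The covariant derivative has
    no component along phi, so its remaining components in the spinor basis give eta and S. *)
Lemma torsionP p v : snabla sp nb phi p v =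
  etaof sp nb phi p v *: jmul c (phi p) +
  cmul sp p (v *m Sof sp nb phi p) (phi p).
Proof.
(* Linearity in the direction provides a matrix, so that eta and S come out as matrices too. *)
have [N NE] : exists N : 'M[R]_(8, 6), forall v, snabla sp nb phi p v = N *m v^T.
  exists (\matrix_(r, i) snabla sp nb phi p (delta_mx 0 i) r 0) => {}v.
  have sumE (s : seq 'I_6) : snabla sp nb phi p (\sum_(i <- s) v 0 i *: delta_mx 0 i)
      = \sum_(i <- s) v 0 i *: snabla sp nb phi p (delta_mx 0 i).
    elim: s => [|i s IHs]; last by rewrite !big_cons snabla_linear IHs.
    rewrite !big_nil.
    by have := snabla_linear p (-1) 0 0; rewrite scaler0 addr0 scaleN1r addNr.
  rewrite {1}[v]row_sum_delta sumE; apply/colP => r; rewrite mxE summxE.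
  by apply: eq_bigr => i _; rewrite !mxE mulrC.
suff : [set t : 'M[R]_6 * 'cV[R]_6 | forall v, snabla sp nb phi p v =
    (v *m t.2) 0 0 *: jmul c (phi p) + cmul sp p (v *m t.1) (phi p)]
    (torsion sp nb phi p) by exact.
apply: getPex; exists (N^T *m E p *m F p, N^T *m jmul c (phi p)) => {}v /=.
rewrite cmulE cvec_mul -!mulmxA (frame_coframe (dom_at p)) mulmx1.
rewrite !trmx_mul trmxK -!mulmxA -NE [LHS](spinor_basis c (phi1 p)).
rewrite sinnerC snabla_phi scale0r add0r; congr (_ *: _ + _).
by rewrite NE sinnerC /sinner trmx_mul trmxK -!mulmxA.
Qed.

Lemma etaofE p v : etaof sp nb phi p v = sinner (snabla sp nb phi p v) (jmul c (phi p)).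
Proof.
rewrite torsionP sinnerDl sinnerZl cmulE sinner_cvec_jmul addr0.
by rewrite sinner_jmul jmul_jmul sinnerNr opprK phi1 mulr1.
Qed.

(** The endomorphism S in the orthonormal frame, in the form used by the pointwise Dirac
    identities. *)
Definition frame_torsion p : 'M[R]_6 := \matrix_(i, k)
  sinner (snabla sp nb phi p (fr p i p)) (cgen c k *m phi p).

Lemma frame_torsionE p : frame_torsion p = F p *m Sof sp nb phi p *m P p.
Proof.
apply/matrixP => i k; rewrite mxE torsionP sinnerDl sinnerZl.
rewrite -cvec_delta [sinner (jmul c _) _]sinnerC sinner_cvec_jmul mulr0 add0r.
rewrite cmulE sinner_cvec2 phi1 mulr1.
by rewrite trmx_delta -colE -frame_mx_row -!mulmxA -rowE !mxE.
Qed.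

Lemma mxtrace_frame_torsion p : \tr (frame_torsion p) = \tr (Sof sp nb phi p).
Proof.
by rewrite frame_torsionE mxtrace_mulC mulmxA (coframe_frame (dom_at p)) mul1mx.
Qed.

Lemma mxtrace_frame_torsion_acs p :
  \tr (frame_torsion p *m K p) = - \tr (Sof sp nb phi p *m acs sp phi p).
Proof.
rewrite frame_torsionE acsE mulmxN raddfN /= opprK -!mulmxA mxtrace_mulC.
by rewrite !mulmxA.
Qed.

Lemma dirac_opE p :
  dirac_op sp nb phi p = \sum_i cgen c i *m snabla sp nb phi p (fr p i p).
Proof. by apply: eq_bigr => i _; rewrite cmul_frame. Qed.

(** With constant y and z, omega is a constant quadratic form in phi. The terms in nabla Y and nabla
    Z are commutators of the spin connection with y and z; skewness of the spin connection and its
    commuting with j cancel everything but the covariant derivatives of phi. *)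
Lemma nabla2_omega p v (y z : 'rV[R]_6) :
  nabla2 nb (omega sp phi) p v (fun q => \sum_i y 0 i *: fr p i q)
    (fun q => \sum_i z 0 i *: fr p i q) =
  sinner (cvec c y *m snabla sp nb phi p v) (jmul c (cvec c z *m phi p)) +
  sinner (cvec c y *m phi p) (jmul c (cvec c z *m snabla sp nb phi p v)).
Proof.
have oU := gdom_open (gauge_at sp p); have Up := dom_at p.
have sm i := @frame_smooth _ _ _ _ _ sp (gauge_at sp p) i.
pose X (x : 'rV[R]_6) : vfield R M := fun q => \sum_i x 0 i *: fr p i q.
have coordX x q : gdom (gauge_at sp p) q ->
    X x q *m coframe_mx (gauge_at sp p) q = x.
  by move=> Uq; rewrite /X -row_frame_mx -mulmxA frame_coframe // mulmx1.
have coord_nabla x : nabla nb (X x) p v *m P p = x *m conn_mx p v.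
  rewrite (nabla_lincomb nb v _ _ oU Up sm).2 mulmx_suml mulmx_sum_row.
  apply: eq_bigr => i _; rewrite -scalemxAl -frame_coordE; congr (_ *: _).
  by apply/rowP => b; rewrite !mxE.
rewrite /nabla2 -/(X y) -/(X z).
rewrite !(omega_in_gauge _ _ Up) in_gauge_at !coord_nabla !coordX //.
(* The minus sign comes from moving y to the second argument. *)
pose B := - (cvec c y *m (jmx c *m cvec c z)).
have BE u u' :
    sinner u (B *m u') = sinner (cvec c y *m u) (jmul c (cvec c z *m u')).
  by rewrite sinner_cvec -sinnerNr /jmul /B mulNmx !mulmxA.
rewrite (der_near A (h := fun q => sinner (in_gauge (gauge_at sp p) phi q)
  (B *m in_gauge (gauge_at sp p) phi q) : R^o) v oU Up); last first.
  by move=> q Uq; rewrite BE (omega_in_gauge _ _ Uq) !coordX.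
rewrite /der (derive_sinner _ (@in_gauge_derivable p v)) /= in_gauge_param.
rewrite -/(der A p v (in_gauge (gauge_at sp p) phi)).
have -> : der A p v (in_gauge (gauge_at sp p) phi) =
    snabla sp nb phi p v - spin_conn c (conn_mx p v) *m phi p.
  by rewrite snablaE addrK.
rewrite !BE; move: (snabla _ _ _ _ _) (phi p) => D u.
have Gsk := conn_mx_skew p v; move: (conn_mx p v) Gsk => G Gsk.
have sc x : cvec c x *m (spin_conn c G *m u) =
    spin_conn c G *m (cvec c x *m u) - cvec c (x *m G) *m u.
  by rewrite !mulmxA (spin_conn_cvec c Gsk) mulmxDl addrK.
have cj u' : jmul c (spin_conn c G *m u') = spin_conn c G *m jmul c u'.
  by rewrite /jmul !mulmxA spin_conn_jmx.
rewrite !mulmxBr !sc /jmul !mulmxBr -!/(jmul c _) cj.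
rewrite !(sinnerDl, sinnerDr, sinnerNl, sinnerNr).
rewrite (sinner_skew _ _ (spin_conn_skew c G)).
ring.
Qed.

Lemma codiff_omega p v : codiff sp nb (omega sp phi) p v =
  - 2 * sinner (dirac_op sp nb phi p) (jmul c (cmul sp p v (phi p)))
  - 2 * etaof sp nb phi p v.
Proof.
(* Both fields in the codifferential are rewritten with constant frame coefficients, as
   [nabla2_omega] requires. *)
have frE i : fr p i = fun q => \sum_l (delta_mx 0 i : 'rV[R]_6) 0 l *: fr p l q.
  by apply/funext => q; rewrite -row_frame_mx frame_mx_row.
have extE : extend sp p v = fun q => \sum_i (v *m P p) 0 i *: fr p i q.
  apply/funext => q; apply: eq_bigr => i _.
  by rewrite -frame_coordE mxE.
have etaE : etaof sp nb phi p v = \sum_i (v *m P p) 0 i *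
    sinner (snabla sp nb phi p (fr p i p)) (jmul c (phi p)).
  rewrite {1}(_ : v = v *m P p *m F p); last first.
    by rewrite -mulmxA (coframe_frame (dom_at p)) mulmx1.
  rewrite row_frame_mx /etaof mulmx_suml summxE; apply: eq_bigr => i _.
  by rewrite -etaofE /etaof -scalemxAl mxE.
rewrite /codiff dirac_opE cmulE etaE.
have := codiff_dirac c (phi p) (fun i => snabla sp nb phi p (fr p i p)) (v *m P p).
set D := sinner _ _; set e := \sum_i _ => main.
rewrite mulNr -opprD -main; congr (- _); apply: eq_bigr => i _.
by rewrite extE [X in nabla2 _ _ _ _ X]frE nabla2_omega cvec_delta.
Qed.

Lemma dirac_op_phi p :
  sinner (dirac_op sp nb phi p) (phi p) = - \tr (Sof sp nb phi p).
Proof. by rewrite dirac_opE dirac_phi -/(frame_torsion p) mxtrace_frame_torsion. Qed.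

Lemma dirac_op_jphi p : sinner (dirac_op sp nb phi p) (jmul c (phi p)) =
  - \tr (Sof sp nb phi p *m acs sp phi p).
Proof.
by rewrite dirac_opE (dirac_jphi c (phi1 p)) -/(frame_torsion p)
  mxtrace_frame_torsion_acs.
Qed.

Lemma dirac_op_eq0 p : dirac_op sp nb phi p = 0 <->
  [/\ \tr (Sof sp nb phi p) = 0, \tr (Sof sp nb phi p *m acs sp phi p) = 0 &
    forall v, codiff sp nb (omega sp phi) p v = - 2 * etaof sp nb phi p v].
Proof.
rewrite dirac_opE (dirac_eq0 c (phi1 p)) /= -/(frame_torsion p) mxtrace_frame_torsion.
rewrite mxtrace_frame_torsion_acs -dirac_opE.
split=> -[trS /eqP + D0]; rewrite ?oppr_eq0 => /eqP trSJ; split=> //.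
- by move=> v; rewrite codiff_omega cmulE D0 mulr0 sub0r mulNr.
- by rewrite trSJ oppr0.
(* The vector with frame components x turns the tangential condition into the pointwise one. *)
move=> x; have := D0 (x *m F p); rewrite codiff_omega cmulE -mulmxA.
by rewrite (frame_coframe (dom_at p)) mulmx1 => ?; lra.
Qed.

Lemma chi22bar345_torsion p :
  chi22bar345 (inner g p) (acs sp phi p) (torsion sp nb phi p) <->
  \tr (Sof sp nb phi p) = 0 /\ \tr (Sof sp nb phi p *m acs sp phi p) = 0.
Proof.
exact: (chi22bar345P (gram_sym g p) (gram_inv (dom_at p)) (acs_sqr p) (acs_skew p)).
Qed.

Lemma chi1_components_torsion p (l m : R) :
  chi1_components (inner g p) (acs sp phi p) (torsion sp nb phi p)
    (l *: acs sp phi p, 0) (m%:M, 0) <->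
  l = - 6^-1 * \tr (Sof sp nb phi p *m acs sp phi p) /\
  m = 6^-1 * \tr (Sof sp nb phi p).
Proof.
exact: (chi1_componentsP (gram_sym g p) (gram_inv (dom_at p)) (acs_sqr p)
  (acs_skew p)).
Qed.

End SpinorField.

Theorem theorem3p7 (R : realType) (M : topologicalType) (A : manifold6 R M)
    (g : metric A) (c : clifford_rep R) (sp : spin_structure g c)
    (nb : levi_civita g) :
  ((exists phi : sfield R M, unit_spinor_field sp phi /\
      forall p, dirac_op sp nb phi p = 0)
   <->
   (exists phi : sfield R M, unit_spinor_field sp phi /\
      (forall p, chi22bar345 (inner g p) (acs sp phi p) (torsion sp nb phi p)) /\
      (forall p v, codiff sp nb (omega sp phi) p v = - 2 * etaof sp nb phi p v)))
  /\
  (forall phi : sfield R M, unit_spinor_field sp phi -> forall p : M,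
     let J := acs sp phi p in
     let S := Sof sp nb phi p in
     let Dphi := dirac_op sp nb phi p in
     [/\ 6^-1 * sinner Dphi (jmul c (phi p)) = - 6^-1 * \tr (S *m J),
         - 6^-1 * sinner Dphi (phi p) = 6^-1 * \tr S
       & forall lambda mu : R,
           chi1_components (inner g p) J (torsion sp nb phi p)
             (lambda *: J, 0) (mu%:M, 0) <->
           lambda = 6^-1 * sinner Dphi (jmul c (phi p)) /\
           mu = - 6^-1 * sinner Dphi (phi p)]).
Proof.
split.
  (* The same spinor field serves in both directions, the equivalence being pointwise. *)
  split=> -[phi [phiU]] => [D0|[chis delta]]; exists phi; split=> //.
    have D0P p := (dirac_op_eq0 nb phiU p).1 (D0 p).
    by split=> p; case: (D0P p) => // trS trSJ _; apply/chi22bar345_torsion.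
  move=> p; apply/dirac_op_eq0 => //; have /chi22bar345_torsion := chis p.
  by case=> // trS trSJ; split.
move=> phi phiU p J S Dphi.
have eJ : 6^-1 * sinner Dphi (jmul c (phi p)) = - 6^-1 * \tr (S *m J).
  by rewrite dirac_op_jphi // mulrN mulNr.
have eI : - 6^-1 * sinner Dphi (phi p) = 6^-1 * \tr S.
  by rewrite dirac_op_phi // mulrN mulNr opprK.
by split=> // l m; rewrite eJ eI; exact: chi1_components_torsion.
Qed.
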